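(* Let $0<\epsilon<1$, let $\{\mathbb{P}_{\theta}:\theta\in\Theta\subseteq\mathbb{R}^n\}$ be a parametric family of probability distributions on $\mathbb{R}^d$ containing the true distribution of the random vector $\tilde{\xi}$ (i.e. the true distribution is $\mathbb{P}_{\theta^c}$ for some $\theta^c\in\Theta$), and let $\Theta_{\mathcal{S}^N}\subseteq\Theta$. Let $g:\mathbb{R}^d\times\mathbb{R}^k\to\mathbb{R}$ be such that $g(\cdot,x)$ is concave and finite-valued for every $x\in\mathbb{R}^k$. If the non-empty, convex and compact set $\Xi_\epsilon\subseteq\mathbb{R}^d$ satisfies $$\delta^*(v|\Xi_\epsilon)\ \geq\ \sup_{\theta\in\Theta_{\mathcal{S}^N}}\text{VaR}_\epsilon^{\mathbb{P}_{\theta}}(v^T\tilde{\xi})\qquad\text{for every } v\in\mathbb{R}^d,$$ then for any $x^*\in\mathbb{R}^k$, the constraint $$g(\xi,x^* )\leq 0,\quad\forall\,\xi\in\Xi_\epsilon,$$ implies $$\inf_{\theta\in\Theta_{\mathcal{S}^N}}\mathbb{P}_{\theta}\big(g(\tilde{\xi},x^* )\leq 0\big)\geq 1-\epsilon.$$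
   Context: For $v\in\mathbb{R}^d$, $0<\epsilon<1$ and a probability distribution $\mathbb{P}$ of $\tilde{\xi}$, the support function of a set $\Xi\subseteq\mathbb{R}^d$ is $\delta^*(v|\Xi)=\sup_{\xi\in\Xi}v^T\xi$, and the Value at Risk is $\text{VaR}_\epsilon^{\mathbb{P}}(v^T\tilde{\xi})=\inf\{t:\mathbb{P}(v^T\tilde{\xi}\leq t)\geq 1-\epsilon\}$. $\mathbb{P}_\theta(g(\tilde\xi,x)\le 0)$ is the probability of the event when $\tilde\xi$ has distribution $\mathbb{P}_\theta$. The set $\Theta_{\mathcal{S}^N}$ is a subset of the parameter space $\Theta$ (constructed from a data sample $\mathcal{S}^N$). *)

(* Defs.v *)
From HB Require Import structures.
From mathcomp Require Import all_boot all_order all_algebra.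
From mathcomp Require Import all_classical all_reals all_analysis.

Set Implicit Arguments.
Unset Strict Implicit.
Unset Printing Implicit Defensive.

Import Order.TTheory GRing.Theory Num.Theory.
Import numFieldNormedType.Exports.

Local Open Scope classical_set_scope.
Local Open Scope ring_scope.
Local Open Scope convex_scope.

(* Vectors of R^d are rows, 'rV[R]_d, with the library's topology.  The type
   below is convertible to 'rV[R]_d; it carries the Borel sigma-algebra. *)
Notation borel_rV R d := (g_sigma_algebraType (@open 'rV[R]_d)).

Definition dotv (R : realType) (d : nat) (v xi : 'rV[R]_d) : R :=
  \sum_(i < d) v ord0 i * xi ord0 i.

(* Mirrors the library's convex_function, with the inequality reversed. *)
Definition concave_function (R : numFieldType) (E : lmodType R)
    (E' := convex_lmodType E) (D : set E') (f : E' -> R^o) : Prop :=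
  forall t : {i01 R},
    {in D &, forall x y : E', f x <| t |> f y <= f (x <| t |> y)}.

(* Extended-real valued: -oo if Xi is empty, +oo if Xi is unbounded along v. *)
Definition support_function (R : realType) (d : nat) (Xi : set 'rV[R]_d)
    (v : 'rV[R]_d) : \bar R :=
  ereal_sup [set (dotv v xi)%:E | xi in Xi].

Definition VaR (disp : measure_display) (T : measurableType disp)
    (R : realType) (eps : R) (P : probability T R) (X : T -> R) : \bar R :=
  ereal_inf [set t%:E | t in
    [set t : R | ((1 - eps)%:E <= P [set w | (X w <= t)%R])%E]].

(* Main.v *)
Require Import Defs.
From HB Require Import structures.
From mathcomp Require Import all_boot all_order all_algebra.
From mathcomp Require Import all_classical all_reals all_analysis.
From mathcomp Require Import ring lra.

Set Implicit Arguments.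
Unset Strict Implicit.
Unset Printing Implicit Defensive.

Import Order.TTheory GRing.Theory Num.Theory.
Import numFieldNormedType.Exports.

Local Open Scope classical_set_scope.
Local Open Scope ring_scope.


(** Fix theta and x, write f for g(., x), P for the law, and suppose that f <= 0
    on Xi.  The event {f > 0} is convex and disjoint from Xi, so some halfspace
    {v . xi <= c} contains Xi and misses {f > 0}; the hypothesis on Xi bounds
    the Value at Risk of v . xi by c, which says that this halfspace, hence
    also {f <= 0}, has probability at least 1 - eps.

    Separating Xi from {f > 0} itself may leave no gap between c and the Value
    at Risk, which is an infimum of admissible levels.  So {f > 0} is exhausted
    by the compact convex sets
      K n = {f >= 1 / (n + 1)} /\ {|xi| <= n}.
    Two disjoint nonempty compact convex sets are separated with a positive gap
    (compact_convex_separate: take the point of least Euclidean norm of the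
    difference set), and the gap leaves room for a level t that is above the
    Value at Risk and still below K n in the direction v.  Hence the
    complement of K n has probability at least 1 - eps
    (probability_compl_compact_convex).  These complements decrease to
    {f <= 0}, and continuity of P from above gives the bound.

    The sets K n are closed, and {f <= 0} is measurable, because a finite
    concave function on R^d is continuous (concave_continuous). *)

(** * Convexity in terms of real weights *)

Lemma concave_functionP (R : numFieldType) (E : lmodType R) (f : E -> R)
    (cf : @concave_function R E setT f) (x y : E) (t : R) :
  0 <= t -> t <= 1 -> t * f x + (1 - t) * f y <= f (t *: x + (1 - t) *: y).
Proof.
by move=> t0 t1; exact: cf (Itv01 t0 t1) x y (in_setT _) (in_setT _).
Qed.

Lemma convex_setP (R : numFieldType) (E : lmodType R) (A : set E) :
  @convex_set R E A <->
  forall (x y : E) (t : R), A x -> A y -> 0 <= t -> t <= 1 ->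
    A (t *: x + (1 - t) *: y).
Proof.
split=> [cA x y t Ax Ay t0 t1|cA x y t /set_mem Ax /set_mem Ay].
  by have /set_mem := cA x y (Itv01 t0 t1) (mem_set Ax) (mem_set Ay).
by apply/mem_set/(cA x y t%:num).
Qed.

Lemma concave_ge_min (R : realFieldType) (E : lmodType R) (f : E -> R)
    (cf : @concave_function R E setT f) (x y : E) (t m : R) :
  0 <= t -> t <= 1 -> m <= f x -> m <= f y -> m <= f (t *: x + (1 - t) *: y).
Proof.
move=> t0 t1 mx my; apply: le_trans (concave_functionP cf x y t0 t1).
have -> : m = t * m + (1 - t) * m by rewrite -mulrDl addrC subrK mul1r.
by apply: lerD; apply: ler_wpM2l; rewrite // subr_ge0.
Qed.

(** * Continuity of finite concave functions on R^d *)

(** Induction on the number of directions: halving splits a displacement into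
    one along the earlier directions and one along the last direction, both
    doubled, and concavity bounds f below by the smaller of the two values.
    The radius is quantified inside the induction because of this doubling.
    Along a single direction, f is at least the smaller of its values at the
    two ends of the segment. *)
Lemma concave_lbounded_box (R : realFieldType) (E : lmodType R) (f : E -> R)
    (I : Type) (e : I -> E) (s : seq I) (x : E) (r : R) :
  @concave_function R E setT f -> 0 < r ->
  exists m, forall c : I -> R, (forall i, `|c i| <= r) ->
    m <= f (x + \sum_(i <- s) c i *: e i).
Proof.
move=> cf; elim: s r => [|j s IH] r r0.
  by exists (f x) => c _; rewrite big_nil addr0.
have r20 : 0 < 2 * r by rewrite mulr_gt0.
have [m1 hm1] := IH _ r20.
pose m2 := Num.min (f (x + (2 * r) *: e j)) (f (x - (2 * r) *: e j)).
exists (Num.min m1 m2) => c hc; rewrite big_cons.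
have half0 : 0 <= 2^-1 :> R by rewrite invr_ge0.
have half1 : 2^-1 <= 1 :> R by rewrite invf_le1// ler1n.
have half : 1 - 2^-1 = 2^-1 :> R by field.
have -> : x + (c j *: e j + \sum_(i <- s) c i *: e i) =
  2^-1 *: (x + \sum_(i <- s) (2 * c i) *: e i) +
  (1 - 2^-1) *: (x + (2 * c j) *: e j).
  rewrite half !scalerDr scaler_sumr scalerA mulKf ?pnatr_eq0//.
  under [in RHS]eq_bigr do rewrite scalerA mulKf ?pnatr_eq0//.
  rewrite addrACA -scalerDl (_ : 2^-1 + 2^-1 = 1 :> R) ?scale1r; last by field.
  by rewrite [X in _ = x + X]addrC.
apply: concave_ge_min => //.
  rewrite ge_min hm1// => i; rewrite normrM ger0_norm//.
  by rewrite ler_pM2l.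
(* the weight of the end 2 r in the point 2 c j of the segment [- 2 r, 2 r] *)
pose t := (2 * c j + 2 * r) / (4 * r).
have := hc j; rewrite ler_norml => /andP[c1 c2].
have t0 : 0 <= t by apply: divr_ge0; lra.
have t1 : t <= 1 by rewrite ler_pdivrMr; lra.
have -> : x + (2 * c j) *: e j =
    t *: (x + (2 * r) *: e j) + (1 - t) *: (x - (2 * r) *: e j).
  rewrite !scalerDr !scalerN !scalerA addrACA -scalerDl -scalerBl addrC.
  rewrite (_ : t + (1 - t) = 1) ?scale1r; last by ring.
  rewrite addrC; congr (_ + _ *: _); rewrite /t; field.
  by rewrite gt_eqF.
by apply: concave_ge_min => //; rewrite !ge_min lexx ?orbT.
Qed.

Lemma mx_coord_le_norm (R : realType) d (u : 'rV[R]_d) i :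
  `|u ord0 i| <= `|u|.
Proof.
rewrite [leRHS]/Num.Def.normr /= mx_normrE.
by rewrite (le_bigmax _ (fun ij : 'I_1 * 'I_d => `|u ij.1 ij.2|) (ord0, i)).
Qed.

Lemma concave_lbounded_ball (R : realType) d (f : 'rV[R]_d -> R)
    (x : 'rV[R]_d) :
  @concave_function R 'rV[R]_d setT f ->
  exists m, forall u, `|u| <= 1 -> m <= f (x + u).
Proof.
move=> cf; have [m hm] := concave_lbounded_box
  (fun i : 'I_d => delta_mx ord0 i) (index_enum 'I_d) x cf ltr01.
exists m => u u1; rewrite [u]row_sum_delta; apply: hm => i.
exact: le_trans (mx_coord_le_norm _ _) u1.
Qed.

(** A lower bound on a ball controls the variation of f in both directions.
    With t = |y - x| and u the unit vector from x to y, concavity is used twice: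
    y lies between x and x + u, which bounds f y from below, and x lies between
    y and x - u, which bounds f y from above. *)
Lemma concave_dist_le (R : realType) (E : normedModType R) (f : E -> R)
    (x y : E) (m : R) :
  @concave_function R E setT f ->
  (forall u, `|u| <= 1 -> m <= f (x + u)) -> `|y - x| <= 1 ->
  `|f y - f x| <= `|y - x| * (f x - m).
Proof.
move=> cf hm yx1; have [->|yx] := eqVneq y x.
  by rewrite !subrr !normr0 mul0r.
set t := `|y - x|; have t0 : 0 < t by rewrite normr_gt0 subr_eq0.
pose u := t^-1 *: (y - x).
have u1 : `|u| <= 1 by rewrite normrZ normfV normr_id mulVf// gt_eqF.
have tu : t *: u = y - x by rewrite scalerA mulfV ?scale1r// gt_eqF.
rewrite ler_norml; apply/andP; split.
  have := concave_functionP cf (x + u) x (ltW t0) yx1.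
  have -> : t *: (x + u) + (1 - t) *: x = y.
    rewrite scalerDr tu addrAC -scalerDl [t + _]addrC subrK scale1r.
    by rewrite addrC subrK.
  move=> h.
  have := ler_wpM2l (ltW t0) (hm _ u1).
  rewrite mulrBr; nra.
have hu : `|- u| <= 1 by rewrite normrN.
have t10 : 0 < 1 + t by lra.
have s0 : 0 <= (1 + t)^-1 by rewrite invr_ge0; lra.
have s1 : (1 + t)^-1 <= 1 by rewrite invf_le1//; lra.
have := concave_functionP cf y (x - u) s0 s1.
have -> : 1 - (1 + t)^-1 = (1 + t)^-1 * t by field; rewrite gt_eqF.
have -> : (1 + t)^-1 *: y + ((1 + t)^-1 * t) *: (x - u) = x.
  rewrite -scalerA -scalerDr scalerBr tu opprB [y + _]addrC -addrA subrK.
  rewrite -{2}[x]scale1r -scalerDl scalerA [t + 1]addrC mulVf ?scale1r//.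
  by rewrite gt_eqF.
rewrite -mulrA -mulrDr mulrC ler_pdivrMr// => h.
have := ler_wpM2l (ltW t0) (hm _ hu).
rewrite mulrBr; nra.
Qed.

Lemma concave_continuous (R : realType) d (f : 'rV[R]_d -> R) :
  @concave_function R 'rV[R]_d setT f -> continuous f.
Proof.
move=> cf x; have [m hm] := concave_lbounded_ball x cf.
have M0 : 0 < f x - m + 1.
  by have := hm 0; rewrite normr0 addr0 => /(_ ler01); lra.
apply/(@cvgrPdist_lt _ _ _ (nbhs x)) => e e0.
have r0 : 0 < Num.min 1 (e / (f x - m + 1)) by rewrite lt_min ltr01 divr_gt0.
apply: filterS (nbhsx_ballx x _ r0) => y.
rewrite -ball_normE /= distrC [in X in _ -> X]distrC lt_min => /andP[/ltW yx1].
rewrite ltr_pdivlMr//; apply: le_lt_trans.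
apply: (le_trans (concave_dist_le cf hm yx1)).
by apply: ler_wpM2l => //; lra.
Qed.

(** * The inner product *)

Lemma dotvDr (R : realType) d (v x y : 'rV[R]_d) :
  dotv v (x + y) = dotv v x + dotv v y.
Proof.
by rewrite /dotv -big_split; apply: eq_bigr => i _; rewrite mxE mulrDr.
Qed.

Lemma dotvZr (R : realType) d (v x : 'rV[R]_d) (a : R) :
  dotv v (a *: x) = a * dotv v x.
Proof.
by rewrite /dotv mulr_sumr; apply: eq_bigr => i _; rewrite mxE mulrCA.
Qed.

Lemma dotvC (R : realType) d (v x : 'rV[R]_d) : dotv v x = dotv x v.
Proof. by apply: eq_bigr => i _; rewrite mulrC. Qed.

Lemma dotvBr (R : realType) d (v x y : 'rV[R]_d) :
  dotv v (x - y) = dotv v x - dotv v y.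
Proof. by rewrite -scaleN1r dotvDr dotvZr mulN1r. Qed.

Lemma dotvv_add (R : realType) d (v w : 'rV[R]_d) (t : R) :
  dotv (v + t *: w) (v + t *: w) =
  dotv v v + 2 * t * dotv v w + t * t * dotv w w.
Proof.
rewrite dotvDr dotvZr ![dotv (v + _) _]dotvC !dotvDr !dotvZr (dotvC w v).
by ring.
Qed.

Lemma dotvv_gt0 (R : realType) d (v : 'rV[R]_d) : v != 0 -> 0 < dotv v v.
Proof.
move=> v0; have ge0 i : 0 <= v ord0 i * v ord0 i by rewrite -expr2 sqr_ge0.
rewrite lt_neqAle sumr_ge0 ?andbT//; apply: contra v0 => /eqP/esym/eqP.
rewrite psumr_eq0// => /allP h; apply/eqP/rowP => i; rewrite mxE.
by have := h i (mem_index_enum i); rewrite /= mulf_eq0 orbb => /eqP.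
Qed.

Lemma cvg_coord (R : realType) d (T : Type) (F : set_system T)
    (u : T -> 'rV[R]_d) (u0 : 'rV[R]_d) (i : 'I_d) : Filter F ->
  u @ F --> u0 -> (u z ord0 i : R) @[z --> F] --> (u0 ord0 i : R).
Proof.
move=> FF uu0.
exact: (@cvg_comp _ _ _ u (fun M : 'rV[R]_d => M ord0 i : R) _ _ _ uu0
  (@coord_continuous R 1 d ord0 i u0)).
Qed.

Lemma cvg_dotv (R : realType) d (T : Type) (F : set_system T)
    (u w : T -> 'rV[R]_d) (u0 w0 : 'rV[R]_d) : Filter F ->
  u @ F --> u0 -> w @ F --> w0 ->
  dotv (u z) (w z) @[z --> F] --> dotv u0 w0.
Proof.
move=> FF uu0 ww0; apply: cvg_big; first exact: add_continuous.
move=> i _; have ui := cvg_coord (i := i) FF uu0.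
have wi := cvg_coord (i := i) FF ww0.
exact: (@cvgM R _ _ _ (fun z => u z ord0 i) (fun z => w z ord0 i) _ _ ui wi).
Qed.

Lemma dotv_continuous (R : realType) d (v : 'rV[R]_d) : continuous (dotv v).
Proof.
move=> x; have cv : cst v @ nbhs x --> v by apply: cvg_cst.
have cx : id @ nbhs x --> x by apply: cvg_id.
exact: (cvg_dotv _ cv cx).
Qed.

Lemma dotvv_continuous (R : realType) d :
  continuous (fun x : 'rV[R]_d => dotv x x).
Proof.
move=> x; have cx : id @ nbhs x --> x by apply: cvg_id.
exact: (cvg_dotv _ cx cx).
Qed.

(** * Separation of compact convex sets *)

(** The vector v is the point of S of least Euclidean norm: if dotv v s were
    less than dotv v v, moving from v a little towards s would stay in S and
    decrease the norm. *)
Lemma compact_convex_separate0 (R : realType) d (S : set 'rV[R]_d) :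
  S !=set0 -> compact S -> @convex_set R 'rV[R]_d S -> ~ S 0 ->
  exists v, exists2 c, 0 < c & forall s, S s -> c <= dotv v s.
Proof.
move=> S0 cS vS nS.
have [v /set_mem Sv vmin] := EVT_min_rV S0 cS
  (continuous_subspaceT (@dotvv_continuous R d)).
exists v, (dotv v v).
  by apply: dotvv_gt0; apply/eqP => v0; apply: nS; rewrite -v0.
move=> s Ss; rewrite leNgt; apply/negP => lt_s.
pose a := dotv v v - dotv v s; pose b := dotv (s - v) (s - v).
have a0 : 0 < a by rewrite subr_gt0.
have b0 : 0 <= b.
  by rewrite /b; apply: sumr_ge0 => i _; rewrite -expr2 sqr_ge0.
have ab0 : 0 < a + b by lra.
(* On the segment from v to s the squared norm changes by t (t b - 2 a), which
   is negative as soon as t b < 2 a; the choice a / (a + b) satisfies this and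
   is at most 1. *)
pose t := a / (a + b).
have t0 : 0 < t by apply: divr_gt0.
have t1 : t <= 1 by rewrite ler_pdivrMr//; lra.
have := vmin _ (mem_set ((convex_setP S).1 vS _ _ _ Ss Sv (ltW t0) t1)).
have -> : t *: s + (1 - t) *: v = v + t *: (s - v).
  by rewrite scalerBl scale1r scalerBr addrCA.
rewrite dotvv_add -/b dotvBr => h.
have tab : t * (a + b) = a by rewrite mulfVK// gt_eqF.
have : t * (t * b - 2 * a) >= 0 by rewrite /a; lra.
rewrite pmulr_rge0//; nra.
Qed.

Lemma compact_convex_separate (R : realType) d (A B : set 'rV[R]_d) :
  A !=set0 -> B !=set0 -> compact A -> compact B ->
  @convex_set R 'rV[R]_d A -> @convex_set R 'rV[R]_d B -> A `&` B = set0 ->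
  exists v, exists2 c, 0 < c &
    forall a b, A a -> B b -> dotv v a + c <= dotv v b.
Proof.
move=> [a0 Aa0] [b0 Bb0] cA cB vA vB AB.
pose S := (fun p : 'rV[R]_d * 'rV[R]_d => p.2 - p.1) @` (A `*` B).
have [||||v [c c0 hv]] := @compact_convex_separate0 R d S.
- by exists (b0 - a0), (a0, b0).
- apply: continuous_compact; last exact: compact_setX.
  apply: continuous_subspaceT => p.
  by apply: cvgB; [exact: cvg_snd|exact: cvg_fst].
- apply/convex_setP => _ _ t [[a b] /= [Aa Bb] <-] [[a' b'] /= [Aa' Bb'] <-].
  move=> t0 t1.
  exists (t *: a + (1 - t) *: a', t *: b + (1 - t) *: b').
    by split; apply: ((convex_setP _).1 _) => /=.
  by rewrite /= !scalerBr opprD addrACA.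
- move=> [[a b] [/= Aa Bb] /eqP]; rewrite subr_eq0 => /eqP ba.
  have ABa : (A `&` B) a by split => //; rewrite -ba.
  by rewrite AB in ABa.
exists v, c => // a b Aa Bb.
by rewrite addrC -lerBrDr -dotvBr; apply: hv; exists (a, b).
Qed.

(** * Probability of the complement of a convex set *)

Lemma VaR_lt_exists (disp : measure_display) (T : measurableType disp)
    (R : realType) (eps : R) (P : probability T R) (X : T -> R) (c : \bar R) :
  (VaR eps P X < c)%E ->
  exists2 t : R, (t%:E < c)%E & ((1 - eps)%:E <= P [set w | (X w <= t)%R])%E.
Proof. by move=> /ereal_inf_lt[_ [t ht <-] tc]; exists t. Qed.

Lemma closed_measurable_rV (R : realType) d (A : set 'rV[R]_d) :
  closed A -> measurable (A : set (borel_rV R d)).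
Proof.
move=> cA; rewrite -[A]setCK; apply: measurableC.
by apply: sub_sigma_algebra; exact: closed_openC.
Qed.

Lemma closed_sublevel (R : realType) (T : topologicalType) (f : T -> R)
    (c : R) :
  continuous f -> closed [set x | f x <= c].
Proof.
move=> cf; apply: (@preimage_closed T R f [set y | y <= c]).
  by move=> x _; exact: cf.
exact: closed_le.
Qed.

Lemma closed_superlevel (R : realType) (T : topologicalType) (f : T -> R)
    (c : R) :
  continuous f -> closed [set x | c <= f x].
Proof.
move=> cf; apply: (@preimage_closed T R f [set y | c <= y]).
  by move=> x _; exact: cf.
exact: closed_ge.
Qed.

(** If v separates Xi from K with gap c > 0, the support function s of Xi at v
    satisfies s + c <= v . b for every b in K.  The Value at Risk is less than
    s + c, so some t < s + c already has {v . xi <= t} of probability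
    at least 1 - eps, and this halfspace misses K. *)
Lemma probability_compl_compact_convex (R : realType) (d : nat) (eps : R)
    (P : probability (borel_rV R d) R) (Xi K : set 'rV[R]_d) :
  0 <= eps -> Xi !=set0 -> @convex_set R 'rV[R]_d Xi -> compact Xi ->
  (forall v : 'rV[R]_d,
     (VaR eps P (fun xi => dotv v xi) <= support_function Xi v)%E) ->
  @convex_set R 'rV[R]_d K -> compact K -> Xi `&` K = set0 ->
  ((1 - eps)%:E <= P (~` K))%E.
Proof.
move=> eps0 X0 vX cX hX vK cK XK.
have [->|/set0P K0] := eqVneq K set0.
  by rewrite setC0 probability_setT lee_fin gerBl.
have [v [c c0 hv]] := compact_convex_separate X0 K0 cX cK vX vK XK.
have [b0 Kb0] := K0; have [a0 Xa0] := X0.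
have supp_le b : K b -> (support_function Xi v <= (dotv v b - c)%:E)%E.
  move=> Kb; apply: ge_ereal_sup => _ [a Xa <-]; rewrite lee_fin lerBrDr.
  exact: hv.
have supp_fin : support_function Xi v \is a fin_num.
  rewrite fin_numElt (lt_le_trans (ltNyr (dotv v a0)))/=.
    by rewrite (le_lt_trans (supp_le _ Kb0)) ?ltry.
  by apply: ereal_sup_ubound; exists a0.
(* adding c is a strict increase only because the support function is finite *)
have [|t tc ht] := @VaR_lt_exists _ _ _ eps P (dotv v)
    (support_function Xi v + c%:E)%E.
  by rewrite (le_lt_trans (hX v))// lteDl// lte_fin.
apply: (le_trans ht); apply: le_measure; rewrite ?inE.
- apply: closed_measurable_rV; exact: closed_sublevel (@dotv_continuous R d v).
- apply: measurableC; apply: closed_measurable_rV; exact: compact_closed cK.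
- move=> w /= wt /supp_le; rewrite leNgt => /negP; apply.
  rewrite EFinB lteBlDr//; apply: le_lt_trans tc.
  by rewrite lee_fin.
Qed.

(** The bound for a single law: the complements of the compact convex sets K n
    decrease to {f <= 0}, and each has probability at least 1 - eps. *)
Lemma probability_concave_le0 (R : realType) (d : nat) (eps : R)
    (P : probability (borel_rV R d) R) (Xi : set 'rV[R]_d)
    (f : 'rV[R]_d -> R) :
  0 <= eps -> Xi !=set0 -> @convex_set R 'rV[R]_d Xi -> compact Xi ->
  (forall v : 'rV[R]_d,
     (VaR eps P (fun xi => dotv v xi) <= support_function Xi v)%E) ->
  @concave_function R 'rV[R]_d setT f ->
  (forall xi, Xi xi -> f xi <= 0) ->
  ((1 - eps)%:E <= P [set xi | (f xi <= 0)%R])%E.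
Proof.
move=> eps0 X0 vX cX hX cf Xf.
have ctf := concave_continuous cf.
pose K n : set 'rV[R]_d :=
  [set x | n.+1%:R^-1 <= f x] `&` [set x | `|x| <= n%:R].
have clK n : closed (K n).
  apply: closedI; first exact: closed_superlevel.
  exact: (closed_sublevel (@norm_continuous R 'rV[R]_d)).
have cK n : compact (K n).
  apply: bounded_closed_compact (clK n).
  exists n%:R; split; first exact: num_real.
  by move=> M nM x [_ /= xn]; rewrite (le_trans xn)// ltW.
have vK n : @convex_set R 'rV[R]_d (K n).
  apply/convex_setP => x y t [/= fx nx] [/= fy ny] t0 t1.
  have t1' : 0 <= 1 - t by rewrite subr_ge0.
  split => /=; first exact: concave_ge_min.
  rewrite (le_trans (ler_normD _ _))// !normrZ !ger0_norm//.
  rewrite (_ : n%:R = t * n%:R + (1 - t) * n%:R); last by ring.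
  by apply: lerD; apply: ler_wpM2l.
have XK n : Xi `&` K n = set0.
  rewrite -subset0 => x [/Xf fx [/= kx _]].
  by have := le_trans kx fx; rewrite leNgt invr_gt0 ltr0Sn.
have ndK n m : (n <= m)%N -> K n `<=` K m.
  move=> nm x [/= h1 h2]; split => /=.
    by apply: le_trans h1; rewrite lef_pV2 ?posrE// ler_nat.
  by rewrite (le_trans h2)// ler_nat.
have bigK : \bigcap_n ~` K n = [set xi | f xi <= 0].
  rewrite -setC_bigcup; apply/seteqP; split => x /=.
    move=> nKx; rewrite leNgt; apply/negP => fx; apply: nKx.
    (* N is large enough for both 1 / (N + 1) <= f x and |x| <= N *)
    pose N := maxn (Num.trunc (f x)^-1) (Num.trunc `|x|).+1.
    exists N => //; split => /=.
      rewrite -[leRHS]invrK lef_pV2 ?posrE ?invr_gt0//.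
      apply/ltW/(lt_le_trans (truncnS_gt _)); rewrite ler_nat ltnS.
      exact: leq_maxl.
    apply/ltW/(lt_le_trans (truncnS_gt _)); rewrite ler_nat.
    exact: leq_maxr.
  move=> fx [n _ [/= kx _]].
  by have := le_trans kx fx; rewrite leNgt invr_gt0 ltr0Sn.
have mK n : measurable (~` K n : set (borel_rV R d)).
  by apply: measurableC; exact: closed_measurable_rV (clK n).
have cvgP : P \o (fun n => ~` K n) @ \oo --> P (\bigcap_n ~` K n).
  apply: nonincreasing_cvg_mu => //.
  - exact: le_lt_trans (probability_le1 _ (mK 0%N)) (ltry _).
  - exact: bigcapT_measurable.
  - by move=> n m nm; apply/subsetPset/subsetC/ndK.
rewrite -bigK; apply: (cvge_ge _ cvgP); apply: nearW => n /=.
by apply: (@probability_compl_compact_convex _ _ _ _ Xi).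
Qed.

Theorem theorem1 (R : realType) (d k n : nat) (eps : R)
  (heps0 : 0 < eps) (heps1 : eps < 1)
  (Theta : set 'rV[R]_n)
  (P : 'rV[R]_n -> probability (borel_rV R d) R)
  (disp : measure_display) (Omega : measurableType disp)
  (Pr : probability Omega R) (xit : {RV Pr >-> borel_rV R d})
  (thetac : 'rV[R]_n) (hthetac : Theta thetac)
  (htrue : forall A : set (borel_rV R d), measurable A ->
     distribution Pr xit A = P thetac A)
  (ThetaS : set 'rV[R]_n) (hThetaS : ThetaS `<=` Theta)
  (g : 'rV[R]_d -> 'rV[R]_k -> R)
  (hg : forall x : 'rV[R]_k,
     @concave_function R 'rV[R]_d setT (fun xi => g xi x))
  (Xi : set 'rV[R]_d)
  (hXi0 : Xi !=set0)
  (hXiconv : @convex_set R 'rV[R]_d Xi)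
  (hXicomp : compact Xi)
  (hXi : forall v : 'rV[R]_d,
     (ereal_sup [set VaR eps (P theta) (fun xi => dotv v xi)
                | theta in ThetaS] <= support_function Xi v)%E) :
  forall x : 'rV[R]_k,
    (forall xi : 'rV[R]_d, Xi xi -> g xi x <= 0) ->
    ((1 - eps)%:E <=
       ereal_inf [set P theta [set xi | (g xi x <= 0)%R]
                 | theta in ThetaS])%E.
Proof.
move=> x Xg; apply: le_ereal_inf_tmp => _ [theta Stheta <-].
apply: (probability_concave_le0 (Xi := Xi)) => //; first exact: ltW.
by move=> v; apply: le_trans (hXi v); apply: ereal_sup_ubound; exists theta.
Qed.
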